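(* Let $(f_a)_{a\in\mathcal V}$ be a Multi-GM over a finite multi-graph $\mathcal G=(\mathcal V,\mathcal E)$ and let $\alpha^{(1)},\dots,\alpha^{(|\mathcal E|)}$ be an ordering of the edges. Define $x^{(0)}=x$, $\mathrm Z^{(0)}(x)=z(x)$, where $z(x)=\prod_{a\in\mathcal V}h_a(x_a)\big/\prod_{\alpha\in\mathcal E}(1+x_{\alpha_d}x_{\bar\alpha_d})$ is the Gauge Function, and for $m=1,\dots,|\mathcal E|$ let $x^{(m)}=x^{(m-1)}\setminus\{x_{\alpha_d^{(m)}},x_{\bar\alpha_d^{(m)}}\}$ and $$\mathrm Z^{(m)}(x^{(m)})=\left.\left(1+\partial_{x_{\alpha_d^{(m)}}}\partial_{x_{\bar\alpha_d^{(m)}}}\right)\left(\left(1+x_{\alpha_d^{(m)}}x_{\bar\alpha_d^{(m)}}\right)\mathrm Z^{(m-1)}(x^{(m-1)})\right)\right|_{x_{\alpha_d^{(m)}}=x_{\bar\alpha_d^{(m)}}=0}.$$ Then, for every $m$, $\mathrm Z^{(m)}$ is the Gauge Function of the $m$-th Multi-GM in the edge-elimination sequence: $$\mathrm Z^{(m)}(x^{(m)})=\frac{h^{(m)}(x^{(m)})}{\prod_{\alpha\in\mathcal E^{(m)}}(1+x_{\alpha_d}x_{\bar\alpha_d})},\qquad h^{(m)}(x^{(m)})=\prod_{a\in\mathcal V^{(m)}}\Bigl(\sum_{\varsigma_a\in\Sigma_a^{(m)}}f_a^{(m)}(\varsigma_a)\prod_{\gamma\in e_d^{(m)}(a)}x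_\gamma^{(\varsigma_a)_\gamma}\Bigr).$$
   Context: Multi-graph notation. $\mathcal G=(\mathcal V,\mathcal E)$ is a finite undirected multi-graph; multiple edges and self-edges are allowed. Each $\alpha\in\mathcal E$ has two directed versions, $\alpha_d$ and its reverse $\bar\alpha_d$; $\mathcal E_d$ is the set of all directed edges. Each directed edge is attached to exactly one node: for an edge joining two distinct nodes one of its two directed versions is attached to each end node; for a self-edge both directed versions are attached to its node. $e_d(a)$ is the set of directed edges attached to node $a$, and $\Sigma_a=\{0,1\}^{e_d(a)}$. Multi-GM. Factors $f_a:\Sigma_a\to[0,\infty)$, $a\in\mathcal V$. Variables: $x=(x_\gamma)_{\gamma\in\mathcal E_d}$, $x_a=(x_\gamma)_{\gamma\in e_d(a)}$; $h_a(x_a)=\sum_{s\in\Sigma_a}f_a(s)\prod_{\gamma\in e_d(a)}x_\gamma^{s_\gamma}$. Edge-elimination sequence. Start with $\mathcal G^{(0)}=(\mathcal V^{(0)},\mathcal E^{(0)})=\mathcal G$, $f^{(0)}_a=f_a$. At step $m$, edge $\alpha=\alpha^{(m)}$ is contracted, giving $\mathcal G^{(m)}=(\mathcal V^{(m)},\mathcal E^{(m)})$ with $\mathcal E^{(m)}=\mathcal E^{(m-1)}\setminus\{\alpha\}$; factors of nodes not incident to $\alpha$ are unchanged. If $\alpha$ is a self-edge at $a$, then $\mathcal V^{(m)}=\mathcal V^{(m-1)}$ and the new factor at $a$ is $f_a^{(m)}(s)=\sum_{\tau\in\{0,1\}}f_a^{(m-1)}(s,\,s_{\alpha_d}=s_{\bar\alpha_d}=\tau)$,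 with $s$ indexed by $e_d^{(m)}(a)=e_d^{(m-1)}(a)\setminus\{\alpha_d,\bar\alpha_d\}$. If $\alpha$ joins distinct nodes $b\ne c$, these are merged into one node $a$ with $e_d^{(m)}(a)=(e_d^{(m-1)}(b)\cup e_d^{(m-1)}(c))\setminus\{\alpha_d,\bar\alpha_d\}$ and factor $f_a^{(m)}(s)=\sum_{\tau\in\{0,1\}}f_b^{(m-1)}(s|_b,\tau)\,f_c^{(m-1)}(s|_c,\tau)$, where $\tau$ is the value on the directed version of $\alpha$ attached to $b$, resp. $c$. $\Sigma_a^{(m)}=\{0,1\}^{e_d^{(m)}(a)}$. *)

(* Defs.v *)
From HB Require Import structures.
From mathcomp Require Import all_boot all_order all_algebra.
From mathcomp Require Import all_classical all_reals all_analysis.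
Set Implicit Arguments.
Unset Strict Implicit.
Unset Printing Implicit Defensive.
Import Order.TTheory GRing.Theory Num.Theory numFieldNormedType.Exports.
Local Open Scope ring_scope.

(* The two directed versions of the edge [e] are [(e, false)] and [(e, true)].
   A multi-graph is given by the node to which each directed edge is attached;
   [e] is a self-edge when its two versions are attached to the same node. *)
Definition dedge (E : finType) : finType := (E * bool)%type.

(* A 0/1 configuration of all the directed edges. An element of {0,1}^A is
   encoded as a configuration that vanishes outside A (see [Sigma] below). *)
Definition config (E : finType) : finType := {ffun dedge E -> bool}.

(* All the Multi-GMs of an elimination sequence live over the node type [V] and
   the edge type [E] of the initial graph; [nodes] and [edges] are the current
   nodes and edges. [attached] only matters on the versions of current edges,
   and [factor a] only on [Sigma G a] for a current node [a]. The scalars [K]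
   can be the real numbers, or the complex ones ([0 <= z] in a numFieldType
   implies that [z] is real). *)
Record multiGM (V E : finType) (K : numFieldType) := MultiGM {
  nodes : {set V};
  edges : {set E};
  attached : dedge E -> V;
  factor : V -> config E -> K }.

Section MultiGM.
Variables (V E : finType) (K : numFieldType).
Implicit Types (G : multiGM V E K) (a : V) (e : E) (s : config E).
Implicit Types (x : dedge E -> K).

Definition edges_at G a : {set dedge E} :=
  [set g | (g.1 \in edges G) && (attached G g == a)].

Definition Sigma G a : {set config E} :=
  [set s : config E | [forall g, s g ==> (g \in edges_at G a)]].

Definition node_poly G a x : K :=
  \sum_(s in Sigma G a) factor G a s * \prod_(g in edges_at G a) x g ^+ s g.

Definition gauge_den G x : K :=
  \prod_(e in edges G) (1 + x (e, false) * x (e, true)).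

Definition gauge G x : K :=
  (\prod_(a in nodes G) node_poly G a x) / gauge_den G x.

Definition initial_GM (att : dedge E -> V) (f : V -> config E -> K) :=
  MultiGM [set: V]%SET [set: E]%SET att f.

Definition contract_self_edge G e : multiGM V E K :=
  let b := attached G (e, false) in
  MultiGM (nodes G) (edges G :\ e) (attached G)
    (fun a s =>
       if a == b then
         \sum_(t : bool) factor G b [ffun g => if g.1 == e then t else s g]
       else factor G a s).

(* (s|_b, t) as an element of [Sigma G b], for the directed edge [g0] of [b]. *)
Definition restrict_with G (b : V) (g0 : dedge E) s (t : bool) : config E :=
  [ffun g => if g == g0 then t else (g \in edges_at G b) && s g].

(* The node obtained by merging [b] and [c] keeps the name [b]. *)
Definition merge_edge G e : multiGM V E K :=
  let b := attached G (e, false) in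
  let c := attached G (e, true) in
  MultiGM (nodes G :\ c) (edges G :\ e)
    (fun g => if attached G g == c then b else attached G g)
    (fun a s =>
       if a == b then
         \sum_(t : bool) factor G b (restrict_with G b (e, false) s t)
                         * factor G c (restrict_with G c (e, true) s t)
       else factor G a s).

Definition contract G e : multiGM V E K :=
  if attached G (e, false) == attached G (e, true)
  then contract_self_edge G e else merge_edge G e.

Definition elim_GM G (al : seq E) (m : nat) : multiGM V E K :=
  foldl contract G (take m al).

Definition partial (g : dedge E) (F : (dedge E -> K) -> K) x : K :=
  derive1 (fun t : K => F [eta x with g |-> t]) (x g).

(* The result does not depend on the values of [x] at the two versions of [e],
   so it is a function of the remaining variables. *)
Definition elim_step (F : (dedge E -> K) -> K) e x : K :=
  let W y := (1 + y (e, false) * y (e, true)) * F y in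
  let x0 := [eta x with (e, false) |-> 0, (e, true) |-> 0] in
  W x0 + partial (e, false) (partial (e, true) W) x0.

Definition elim_Z G (al : seq E) (m : nat) : (dedge E -> K) -> K :=
  foldl elim_step (gauge G) (take m al).

End MultiGM.

(* Main.v *)
Require Import Defs.
From mathcomp Require Import all_boot all_order all_algebra.
From mathcomp Require Import all_classical all_reals all_analysis.
From mathcomp Require Import ring.
Set Implicit Arguments.
Unset Strict Implicit.
Unset Printing Implicit Defensive.
Import Order.TTheory GRing.Theory Num.Theory numFieldNormedType.Exports.
Local Open Scope ring_scope.

(** Write [t], [s] for the variables of the two versions of the contracted
    edge.  Each occurs in exactly one node polynomial and to degree at most 1,
    so [h = A + B t + C s + D t s], whether the edge is a self-edge or not, with
    [A], [B], [C], [D] independent of [t] and [s].  Multiplying the gauge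
    function by [1 + t s] cancels the only factor of its denominator that
    involves [t] or [s], whence [(1 + d_t d_s)] evaluated at [t = s = 0] turns
    [h] into [A + D].  This is exactly the sum over the common value 0 or 1 of
    the contracted edge that defines the new factor. *)

(** * Sums over 0/1 configurations of a finite index set *)

Section ConfigurationSum.
Variables (T : finType) (K : comNzRingType).
Implicit Types (A B : {set T}) (s : {ffun T -> bool}) (y : T -> K).
Implicit Types (F : {ffun T -> bool} -> K).

(** Same encoding as [Sigma] (value 0 outside [A]), so that [node_polyE] holds by conversion. *)
Definition configs A : {set {ffun T -> bool}} :=
  [set s : {ffun T -> bool} | [forall g, s g ==> (g \in A)]].

Definition conf_sum A F y : K :=
  \sum_(s in configs A) F s * \prod_(g in A) y g ^+ s g.

Definition conf_upd s (g : T) (t : bool) : {ffun T -> bool} :=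
  [ffun k => if k == g then t else s k].

Definition conf_restr A s : {ffun T -> bool} := [ffun k => (k \in A) && s k].

Lemma configsP A s : reflect (forall g, s g -> g \in A) (s \in configs A).
Proof. by rewrite inE; apply: (iffP forallP) => h g; apply/implyP/h. Qed.

Lemma conf_restr_in A s : conf_restr A s \in configs A.
Proof. by apply/configsP => g; rewrite ffunE => /andP[]. Qed.

Lemma eq_conf_sum A F1 F2 y1 y2 :
  {in configs A, F1 =1 F2} -> {in A, y1 =1 y2} ->
  conf_sum A F1 y1 = conf_sum A F2 y2.
Proof.
move=> eqF eqy; apply: eq_bigr => s sA; rewrite eqF //; congr (_ * _).
by apply: eq_bigr => g gA; rewrite eqy.
Qed.

Lemma conf_sumD A F1 F2 y :
  conf_sum A (fun s => F1 s + F2 s) y = conf_sum A F1 y + conf_sum A F2 y.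
Proof. by rewrite -big_split; apply: eq_bigr => s _; rewrite mulrDl. Qed.

(** Exponents are 0 or 1: sorting configurations by their value at [g] shows that the sum is affine
    in [y g]. *)
Lemma conf_sum_split A g F y : g \in A ->
  conf_sum A F y = conf_sum (A :\ g) (fun s => F (conf_upd s g false)) y
                   + y g * conf_sum (A :\ g) (fun s => F (conf_upd s g true)) y.
Proof.
move=> gA.
have part t : \sum_(s in configs A | s g == t) F s * \prod_(k in A) y k ^+ s k
    = y g ^+ t * conf_sum (A :\ g) (fun s => F (conf_upd s g t)) y.
  (* The inverse map resets [g] to 0, as the encoding demands once [g] has left the index set. *)
  rewrite (reindex_onto (fun s => conf_upd s g t) (fun s => conf_upd s g false)).
    rewrite mulr_sumr; apply: eq_big => s.
      rewrite ffunE !eqxx andbT; apply/andP/configsP => [[]|sA].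
        move=> /configsP sA /eqP <- k; rewrite !ffunE !inE.
        by case: eqVneq => //= kg sk; apply: sA; rewrite ffunE (negPf kg).
      split.
        apply/configsP => k; rewrite ffunE; case: eqVneq => [-> //|_ /sA].
        by rewrite !inE => /andP[].
      apply/eqP/ffunP => k; rewrite !ffunE; case: eqVneq => [->|//].
      by case sg: (s g) => //; move: (sA _ sg); rewrite !inE eqxx.
    move=> _; rewrite (big_setD1 g gA) /= ffunE eqxx mulrCA; congr (_ * (_ * _)).
    by apply: eq_bigr => k; rewrite !inE ffunE => /andP[/negPf ->].
  move=> s /andP[_ /eqP sg]; apply/ffunP => k; rewrite !ffunE.
  by case: eqVneq => [->|].
rewrite {1}/conf_sum (bigID (fun s => s g == false)) /= part expr0 mul1r.
congr (_ + _); rewrite -[y g]expr1 -(part true).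
by apply: eq_bigl => s; case: (s g).
Qed.

(** A pair of configurations on disjoint sets is one configuration of the union; this merges two
    node polynomials into one. *)
Lemma conf_sumM A B F1 F2 y : [disjoint A & B] ->
  conf_sum A F1 y * conf_sum B F2 y
  = conf_sum (A :|: B) (fun s => F1 (conf_restr A s) * F2 (conf_restr B s)) y.
Proof.
move=> dAB; have nB k : k \in A -> k \in B = false by move/(disjointFr dAB).
rewrite /conf_sum big_distrlr pair_big /=.
rewrite (reindex_onto (fun s => (conf_restr A s, conf_restr B s))
           (fun p => [ffun k => p.1 k || p.2 k])) /=.
  apply: eq_big => s.
    rewrite !conf_restr_in /=; apply/eqP/configsP => [<- k|sAB].
      by rewrite !ffunE inE -andb_orl => /andP[].
    apply/ffunP => k; rewrite !ffunE -andb_orl.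
    by case sk: (s k); rewrite ?andbF // andbT -finset.in_setU sAB.
  move=> _; rewrite mulrACA; congr (_ * _).
  rewrite [RHS](eq_bigl (fun k => k \in [predU A & B])); last first.
    by move=> k; rewrite !inE.
  rewrite (bigU _ _ _ dAB) /=; congr (_ * _); apply: eq_bigr => k kA;
    by rewrite ffunE kA.
case=> s1 s2 /= /andP[/configsP s1A /configsP s2B].
congr pair; apply/ffunP => k; rewrite !ffunE.
  case s1k: (s1 k); first by rewrite s1A.
  by case s2k: (s2 k); rewrite ?andbF //= (disjointFl dAB) // s2B.
case s2k: (s2 k); first by rewrite s2B // orbT.
by case s1k: (s1 k); rewrite ?andbF //= nB // s1A.
Qed.

End ConfigurationSum.

(** * Effect of one contraction on the product of node polynomials *)

Section Elimination.
Variables (V E : finType) (K : numFieldType).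
Implicit Types (G : multiGM V E K) (e : E) (x : dedge E -> K).

(** Makes the dependence on the two eliminated variables explicit; [elim_step] evaluates at
    [set_edge x e 0 0]. *)
Definition set_edge x e (t s : K) : dedge E -> K :=
  [eta x with (e, false) |-> t, (e, true) |-> s].

(** Invariant of the elimination: the end nodes of the contracted edge do occur in the product over
    [nodes G]. *)
Definition attached_to_nodes G :=
  forall g : dedge E, g.1 \in edges G -> attached G g \in nodes G.

Lemma edges_contract G e : edges (Defs.contract G e) = edges G :\ e.
Proof. by rewrite /Defs.contract; case: ifP. Qed.

Lemma attached_to_nodes_contract G e : e \in edges G ->
  attached_to_nodes G -> attached_to_nodes (Defs.contract G e).
Proof.
move=> eG wf g; rewrite edges_contract !inE => /andP[_ gG].
rewrite /Defs.contract; case: ifPn => [_|bc] /=; first exact: wf.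
by rewrite !inE; case: ifPn => [_|->]; rewrite ?bc wf.
Qed.

(** Affine only near [s0], because the function to differentiate is controlled only where
    [1 + t * s] is nonzero. *)
Lemma derive1_near_affine (h : K -> K) (a b s0 : K) :
  (\near s0, h s0 = a + b * s0)%classic -> derive1 h s0 = b.
Proof.
move=> hE; rewrite derive1E (near_eq_derive _ hE).
apply: derive_val.
have := is_deriveD (is_derive_cst a s0 1) (is_deriveZ b (is_derive_id s0 (1:K))).
by rewrite add0r /GRing.scale /= mulr1.
Qed.

Lemma node_polyE G a x :
  node_poly G a x = conf_sum (edges_at G a) (Defs.factor G a) x.
Proof. by []. Qed.

Lemma set_edge_neq x e t s g : g.1 != e -> set_edge x e t s g = x g.
Proof.
case: g => e' c /= e'e; rewrite /set_edge /=.
by case: eqP => [[ee _]|_]; [rewrite ee eqxx in e'e |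
   case: eqP => [[ee _]|//]; rewrite ee eqxx in e'e].
Qed.

Lemma set_edgeF x e t s : set_edge x e t s (e, false) = t.
Proof. by rewrite /set_edge /= eqxx. Qed.

Lemma set_edgeT x e t s : set_edge x e t s (e, true) = s.
Proof. by rewrite /set_edge /= eqxx xpair_eqE andbF. Qed.

Lemma node_poly_set_edge G a e x t s :
    attached G (e, false) != a -> attached G (e, true) != a ->
  node_poly G a (set_edge x e t s) = node_poly G a x.
Proof.
move=> neF neT; rewrite !node_polyE; apply: eq_conf_sum => // -[e' c].
rewrite inE /= => /andP[_ att]; apply: set_edge_neq => /=.
by apply: contraTneq att => ->; case: c.
Qed.

(** Only the node [b] of the loop sees [t] and [s]; splitting its polynomial at both versions of [e]
    gives the four coefficients. *)
Lemma contract_self_edge_poly G e x : attached_to_nodes G -> e \in edges G ->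
    attached G (e, false) = attached G (e, true) ->
  exists A B C D : K,
    (forall t s, \prod_(a in nodes G) node_poly G a (set_edge x e t s)
       = A + B * t + C * s + D * t * s) /\
    \prod_(a in nodes (contract_self_edge G e))
       node_poly (contract_self_edge G e) a x = A + D.
Proof.
move=> wf eG loop; set b := attached G (e, false) in loop *.
have bG : b \in nodes G by apply: wf.
set R := \prod_(a in nodes G | a != b) node_poly G a x.
set A0 := edges_at G b :\ (e, false) :\ (e, true).
set P := fun t s => conf_sum A0 (fun c =>
  Defs.factor G b (conf_upd (conf_upd c (e, true) s) (e, false) t)) x.
exists (P false false * R), (P true false * R), (P false true * R),
  (P true true * R); split=> [t s|].
  rewrite (bigD1 b) //= (eq_bigr (fun a => node_poly G a x)) => [|a /andP[_ ab]].
    rewrite -/R node_polyE (conf_sum_split _ _ (g := (e, false))); last first.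
      by rewrite inE /= eG eqxx.
    have eT : (e, true) \in edges_at G b :\ (e, false).
      by rewrite !inE xpair_eqE andbF /= eG -loop eqxx.
    rewrite !(conf_sum_split _ _ eT) set_edgeF set_edgeT.
    have PE t' s' : conf_sum A0 (fun c =>
        Defs.factor G b (conf_upd (conf_upd c (e, true) s') (e, false) t'))
        (set_edge x e t s) = P t' s'.
      apply: eq_conf_sum => // -[e' c]; rewrite !inE !xpair_eqE => cA.
      apply: set_edge_neq => /=; apply: contraTneq cA => ->.
      by rewrite eqxx; case: c.
    by rewrite !PE; ring.
  by rewrite node_poly_set_edge // -?loop eq_sym.
rewrite (bigD1 b) //= -mulrDl; congr (_ * _).
  rewrite node_polyE /= eqxx.
  have -> : edges_at (contract_self_edge G e) b = A0.
    apply/setP => -[e' c]; rewrite !inE /= !xpair_eqE.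
    by case: eqVneq => //= _; case: c.
  rewrite -conf_sumD; apply: eq_conf_sum => // s _.
  (* The new factor sets both versions at once, [P] one after the other. *)
  rewrite big_bool addrC; congr (_ + _); congr (Defs.factor _ _ _);
    apply/ffunP => -[e' c]; rewrite !ffunE !xpair_eqE /=;
    by case: eqVneq => //= _; case: c.
apply: eq_bigr => a /andP[_ ab]; rewrite !node_polyE /= (negPf ab).
congr conf_sum; apply/setP => -[e' c]; rewrite !inE /=.
case: eqVneq => //= ->; rewrite andbC; symmetry; apply/negP => /andP[/eqP + _].
by case: c; rewrite -?loop => ba; rewrite -ba eqxx in ab.
Qed.

(** Brings the arguments of the merged factor to the form that [conf_sum_split] followed by
    [conf_sumM] produces. *)
Lemma restrict_withE G a g s t : restrict_with G a g s t
  = conf_upd (conf_restr (edges_at G a :\ g) s) g t.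
Proof.
by apply/ffunP => k; rewrite !ffunE [k \in _ :\ _]inE inE; case: eqVneq.
Qed.

(** The polynomials of [b] and [c] are [P false + t * P true] and [Q false + s * Q true]; expanding
    their product gives the four coefficients. *)
Lemma merge_edge_poly G e x : attached_to_nodes G -> e \in edges G ->
    attached G (e, false) != attached G (e, true) ->
  exists A B C D : K,
    (forall t s, \prod_(a in nodes G) node_poly G a (set_edge x e t s)
       = A + B * t + C * s + D * t * s) /\
    \prod_(a in nodes (merge_edge G e)) node_poly (merge_edge G e) a x = A + D.
Proof.
move=> wf eG; set b := attached G (e, false); set c := attached G (e, true).
move=> bc.
have bG : b \in nodes G by apply: wf.
have cG : c \in nodes G by apply: wf.
set R := \prod_(a in nodes G | (a != b) && (a != c)) node_poly G a x.
set Ab := edges_at G b :\ (e, false).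
set Ac := edges_at G c :\ (e, true).
set P := fun t =>
  conf_sum Ab (fun z => Defs.factor G b (conf_upd z (e, false) t)) x.
set Q := fun t =>
  conf_sum Ac (fun z => Defs.factor G c (conf_upd z (e, true) t)) x.
exists (P false * Q false * R), (P true * Q false * R), (P false * Q true * R),
  (P true * Q true * R); split=> [t s|].
  rewrite (bigD1 b) // (bigD1 c) /=; last by rewrite cG eq_sym.
  rewrite (eq_bigl (fun a => (a \in nodes G) && ((a != b) && (a != c))));
    last by move=> a; rewrite andbA.
  rewrite (eq_bigr (fun a => node_poly G a x)) => [|a /andP[_ /andP[ab ac]]].
    rewrite -/R !node_polyE (conf_sum_split _ _ (g := (e, false))); last first.
      by rewrite inE /= eG eqxx.
    rewrite [X in _ * (X * _)](conf_sum_split _ _ (g := (e, true))); last first.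
      by rewrite inE /= eG eqxx.
    rewrite set_edgeF set_edgeT -/Ab -/Ac.
    have PE t' : conf_sum Ab (fun z => Defs.factor G b (conf_upd z (e, false) t'))
        (set_edge x e t s) = P t'.
      apply: eq_conf_sum => // -[e' k]; rewrite !inE !xpair_eqE => kA.
      apply: set_edge_neq => /=; apply: contraTneq kA => ->.
      by case: k; rewrite eqxx //= -/c eq_sym (negPf bc) andbF.
    have QE t' : conf_sum Ac (fun z => Defs.factor G c (conf_upd z (e, true) t'))
        (set_edge x e t s) = Q t'.
      apply: eq_conf_sum => // -[e' k]; rewrite !inE !xpair_eqE => kA.
      apply: set_edge_neq => /=; apply: contraTneq kA => ->.
      by case: k; rewrite eqxx //= -/b (negPf bc) andbF.
    by rewrite !PE !QE; ring.
  by rewrite node_poly_set_edge // eq_sym.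
rewrite (bigD1 b) /=; last by rewrite !inE bc.
rewrite -mulrDl; congr (_ * _).
  rewrite node_polyE /= -/b -/c eqxx.
  (* A directed edge is attached to a single node, and [b] differs from [c]. *)
  have dAB : [disjoint Ab & Ac].
    rewrite -setI_eq0; apply/eqP/setP => g; rewrite !inE.
    case: (attached G g =P b) => [->|]; rewrite ?andbF //.
    by rewrite (negPf bc) !andbF.
  have -> : edges_at (merge_edge G e) b = Ab :|: Ac.
    apply/setP => -[e' k]; rewrite !inE /= !xpair_eqE -/c -/b.
    case: (eqVneq e' e) => [->|_] /=.
      by case: k; rewrite /= ?andbF ?orbF // -/b -/c ?(eq_sym c) ?(negPf bc) ?andbF.
    rewrite -andb_orr; congr (_ && _).
    by case: (eqVneq (attached G (e', k)) c) => // _; rewrite ?eqxx ?orbT ?orbF.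
  rewrite /P /Q !conf_sumM // -conf_sumD; apply: eq_conf_sum => // s _.
  by rewrite big_bool addrC !restrict_withE.
apply: eq_big => [a|a /andP[aG ab]].
  by rewrite !inE -/c; case: (a == b); case: (a == c); rewrite ?andbF ?andbT.
rewrite !node_polyE /= -/b (negPf ab).
move: aG; rewrite !inE => /andP[ac _].
(* Reattachment moves versions from [c] to [b] only, so any third node keeps its directed edges. *)
congr conf_sum; apply/setP => -[e' k]; rewrite !inE /= -/b -/c.
case: (eqVneq e' e) => [->|_] /=.
  rewrite eG; symmetry; apply/eqP; case: k; apply/eqP; by rewrite eq_sym.
case: (eqVneq (attached G (e', k)) c) => [->|//].
by rewrite eq_sym (negPf ab) eq_sym (negPf ac).
Qed.

(** Where [gauge] is a genuine quotient and not the default value of a division by 0. *)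
Definition gauge_domain G x :=
  forall e, e \in edges G -> 1 + x (e, false) * x (e, true) != 0.

Lemma contract_poly G e x : attached_to_nodes G -> e \in edges G ->
  exists A B C D : K,
    (forall t s, \prod_(a in nodes G) node_poly G a (set_edge x e t s)
       = A + B * t + C * s + D * t * s) /\
    \prod_(a in nodes (Defs.contract G e)) node_poly (Defs.contract G e) a x
      = A + D.
Proof.
move=> wf eG; rewrite /Defs.contract.
by case: eqVneq; [exact: contract_self_edge_poly | exact: merge_edge_poly].
Qed.

(** * The denominator and the mixed derivative *)

Lemma gauge_den_set_edge G e x t s : e \in edges G ->
  gauge_den G (set_edge x e t s) = (1 + t * s) * gauge_den (Defs.contract G e) x.
Proof.
move=> eG; rewrite /gauge_den edges_contract (big_setD1 e eG) /=.
rewrite set_edgeF set_edgeT; congr (_ * _); apply: eq_bigr => k.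
by rewrite !inE => /andP[ke _]; rewrite !set_edge_neq.
Qed.

(** For [t != 0] the only zero is [s = - t^-1], at distance [|t|^-1] from 0. *)
Lemma near_1Dmul_neq0 (t : K) :
  (\forall s \near (0 : K), 1 + t * s != 0)%classic.
Proof.
have [->|t0] := eqVneq t 0.
  by near=> s; rewrite mul0r addr0 oner_neq0.
have it_gt0 : 0 < `|t|^-1 by rewrite invr_gt0 normr_gt0.
near=> s; have : `|s| < `|t|^-1.
  near: s; exact: (@nbhs0_lt K K _ it_gt0).
apply: contraTneq => /eqP; rewrite addrC addr_eq0 => /eqP ts.
have -> : s = - t^-1 by rewrite -[s](mulKf t0) ts mulrN1.
by rewrite normrN normfV ltxx.
Unshelve. all: by end_near. Qed.

(** For each fixed [t] the formula holds for [s] near 0, so the inner derivative at [s = 0] is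
    [C + D * t] for every [t]. *)
Lemma mixed_partial_set_edge (W : (dedge E -> K) -> K) e x (A B C D : K) :
    (forall t s, 1 + t * s != 0 ->
       W (set_edge x e t s) = A + B * t + C * s + D * t * s) ->
  partial (e, false) (partial (e, true) W) (set_edge x e 0 0) = D.
Proof.
move=> WE.
have updF t s t' : [eta set_edge x e t s with (e, false) |-> t']
    = set_edge x e t' s :> (dedge E -> K).
  by apply/funext => g /=; rewrite /set_edge /=; case: eqP.
have updT t s s' : [eta set_edge x e t s with (e, true) |-> s']
    = set_edge x e t s' :> (dedge E -> K).
  apply/funext => g /=; rewrite /set_edge /=; case: (g =P (e, true)) => // ->.
  by rewrite xpair_eqE andbF.
have innerE t : partial (e, true) W (set_edge x e t 0) = C + D * t.
  rewrite /partial set_edgeT; apply: (@derive1_near_affine _ (A + B * t)).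
  near=> s; rewrite updT WE; first by ring.
  by near: s; exact: near_1Dmul_neq0.
rewrite {1}/partial set_edgeF; apply: (@derive1_near_affine _ C).
by near=> t; rewrite updF innerE.
Unshelve. all: by end_near. Qed.

(** Agreement of [F] on the domain suffices: if [x] is in the domain of the contracted graph,
    [set_edge x e t s] is in that of [G] once [1 + t * s != 0]. *)
Lemma elim_step_gauge (F : (dedge E -> K) -> K) G e :
    attached_to_nodes G -> e \in edges G ->
    (forall x, gauge_domain G x -> F x = gauge G x) ->
  forall x, gauge_domain (Defs.contract G e) x ->
    elim_step F e x = gauge (Defs.contract G e) x.
Proof.
move=> wf eG FE x xdom.
have [A [B [C [D [prodE contrE]]]]] := contract_poly x wf eG.
set d := gauge_den (Defs.contract G e) x.
pose W y := (1 + y (e, false) * y (e, true)) * F y.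
have WE t s : 1 + t * s != 0 ->
    W (set_edge x e t s) = A / d + B / d * t + C / d * s + D / d * t * s.
  move=> ts0; rewrite /W set_edgeF set_edgeT FE.
    rewrite /gauge prodE gauge_den_set_edge // -/d invfM.
    (* Here [1 + t * s] cancels against its inverse. *)
    by rewrite mulrCA mulVKf //; ring.
  move=> k kG; case: (eqVneq k e) => [->|ke].
    by rewrite set_edgeF set_edgeT.
  by rewrite !set_edge_neq //; apply: xdom; rewrite edges_contract !inE ke.
have -> : elim_step F e x = W (set_edge x e 0 0)
    + partial (e, false) (partial (e, true) W) (set_edge x e 0 0) by [].
rewrite (mixed_partial_set_edge WE) WE ?mul0r ?addr0 ?oner_neq0 // /gauge contrE -/d.
by ring.
Qed.

(** General in [F], since after one step the fold restarts from a function known to be the gauge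
    function only on the domain. *)
Lemma foldl_elim_step_gauge (al : seq E) (F : (dedge E -> K) -> K) G :
    attached_to_nodes G -> uniq al -> {subset al <= edges G} ->
    (forall x, gauge_domain G x -> F x = gauge G x) ->
  forall x, gauge_domain (foldl (@Defs.contract V E K) G al) x ->
    foldl (@elim_step E K) F al x = gauge (foldl (@Defs.contract V E K) G al) x.
Proof.
elim: al F G => [|e al IH] F G wf //= /andP[e_al al_uniq] alG FE.
have eG : e \in edges G by apply: alG; rewrite mem_head.
apply: IH => //; first exact: attached_to_nodes_contract.
  (* As [al] has no repetition, the later edges survive the contraction of [e]. *)
  move=> k k_al; rewrite edges_contract !inE alG ?inE ?k_al ?orbT // andbT.
  by apply: contraNneq e_al => <-.
exact: elim_step_gauge.
Qed.

End Elimination.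

Theorem theoremV2 (K : numFieldType) (V E : finType)
    (att : dedge E -> V) (f : V -> config E -> K)
    (f_ge0 : forall (a : V) (s : config E),
       s \in Sigma (initial_GM att f) a -> 0 <= f a s)
    (al : seq E) (al_ordering : perm_eq al (enum E))
    (m : nat) (m_le : (m <= #|E|)%N)
    (x : dedge E -> K)
    (x_dom : forall e : E, e \in edges (elim_GM (initial_GM att f) al m) ->
       1 + x (e, false) * x (e, true) != 0) :
  elim_Z (initial_GM att f) al m x = gauge (elim_GM (initial_GM att f) al m) x.
Proof.
apply: foldl_elim_step_gauge => //.
- by apply: take_uniq; rewrite (perm_uniq al_ordering) enum_uniq.
- by move=> e _; rewrite inE.
Qed.
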